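(* There exist absolute constants $c>0$ and $\epsilon_0>0$ such that for every $\epsilon\in(0,\epsilon_0)$ the following holds: if a (possibly randomized) allocator achieves worst-case expected overhead at most $f(\epsilon)$ against an oblivious adversary for the Memory Reallocation problem with load factor $1-\epsilon$ (for every number of memory slots $M\in\mathbb{Z}^+$), then $f(\epsilon)\ge c\log(\epsilon^{-1})$.
   Context: Memory Reallocation problem: the memory consists of $M$ slots indexed $0,\dots,M-1$; there is a dynamically changing set $X$ of live objects with sizes $\mu(x)\in\mathbb{Z}^+$. An allocation is a map $\phi\colon X\to\{0,\dots,M-1\}$ with $\phi(x)+\mu(x)\le M$ and the intervals $[\phi(x),\phi(x)+\mu(x))$ pairwise disjoint. Starting from $X=\varnothing$, updates (insert a new object of given size, or delete a live object) arrive online; after each update the allocator outputs an allocation of the new set $X'$, possibly moving existing objects. If the update inserts/deletes $x$ and the allocation changes from $\phi$ to $\phi'$, the overhead factor is $1+\frac{1}{\mu(x)}\sum_{y\in X\cap X',\ \phi(y)\ne\phi'(y)}\mu(y)$. An update sequence has load factor $1-\epsilon$ if at all times $\sum_{x\in X}\mu(x)\le(1-\epsilon)M$. A randomized allocator achieves worst-case expected overhead $f(\epsilon)$ against an oblivious adversary if for every $M$ and every update sequence fixed in advance with load factor $1-\epsilon$, each update's overhead factor has expectation at most $f(\epsilon)$. *)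

(* Defs.v *)
From mathcomp Require Import all_boot all_order all_algebra.
From mathcomp Require Import all_classical all_reals all_analysis.

Set Implicit Arguments.
Unset Strict Implicit.
Unset Printing Implicit Defensive.

Import Order.TTheory GRing.Theory Num.Theory.
Local Open Scope ring_scope.

(* The object created by an insertion is named by the (0-based) position of
   that insertion in the update sequence, so every insertion creates a new
   object. [Insert m] inserts an object of size [m]; [Delete x] deletes the
   object named [x]. Sequences are listed in chronological order. *)
Inductive update := Insert of nat | Delete of nat.

Definition inserts (u : update) : bool := if u is Insert _ then true else false.

Definition deletes (x : nat) (u : update) : bool :=
  if u is Delete y then x == y else false.

(* Padding value for [nth]; only read out of range. *)
Definition upd_at (s : seq update) (i : nat) : update := nth (Delete 0%N) s i.

(* mu(x), with junk value 0 when [x] does not name an inserted object. *)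
Definition osize (s : seq update) (x : nat) : nat :=
  if upd_at s x is Insert m then m else 0%N.

(* [live s] is the set X after the updates [s] have been performed; names are
   never reused, so an object is live iff it was inserted and never deleted. *)
Definition live (s : seq update) (x : nat) : bool :=
  [&& (x < size s)%N, inserts (upd_at s x) & ~~ has (deletes x) s].

Definition total_size (s : seq update) : nat :=
  (\sum_(x < size s | live s x) osize s x)%N.

Definition valid_updates (s : seq update) : Prop :=
  forall i, (i < size s)%N ->
    match upd_at s i with
    | Insert m => (0 < m)%N
    | Delete x => live (take i s) x
    end.

Definition has_load_factor (R : realType) (eps : R) (M : nat)
    (s : seq update) : Prop :=
  forall i, (i <= size s)%N ->
    (total_size (take i s))%:R <= (1 - eps) * M%:R.

Definition admissible (R : realType) (eps : R) (M : nat)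
    (s : seq update) : Prop :=
  valid_updates s /\ has_load_factor eps M s.

Definition slots (s : seq update) (phi : nat -> nat) (x : nat) : set nat :=
  [set k | (phi x <= k < phi x + osize s x)%N]%classic.

(* Only the values of [phi] on the live objects are relevant. *)
Definition is_allocation (M : nat) (s : seq update) (phi : nat -> nat) : Prop :=
  (forall x, live s x -> (phi x < M)%N /\ (phi x + osize s x <= M)%N) /\
  (forall x y, live s x -> live s y -> x <> y ->
     (slots s phi x `&` slots s phi y = set0)%classic).

(* A deterministic online strategy: the allocation output after an update is a
   function of the updates received so far. *)
Definition strategy := seq update -> nat -> nat.

Definition upd_size (s : seq update) (i : nat) : nat :=
  match upd_at s i with
  | Insert m => m
  | Delete x => osize s x
  end.

Definition overhead (R : realType) (a : strategy) (s : seq update) (i : nat)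
    : R :=
  let before := take i s in
  let after := take i.+1 s in
  1 + (upd_size s i)%:R^-1 *
      (\sum_(x < i | [&& live before x, live after x
                       & a before x != a after x]) osize s x)%N%:R.

(* Randomized strategies are distributions over deterministic ones, with an
   arbitrary probability space as source of randomness. *)
Record rstrategy (R : realType) := RStrategy {
  rs_disp : measure_display;
  rs_space : measurableType rs_disp;
  rs_prob : probability rs_space R;
  rs_run : rs_space -> strategy
}.
Arguments rs_run {R} r _ _ _.

(* For M slots and load factor 1 - eps. Each output position is required to be
   a random variable, so that expectations are meaningful. *)
Definition is_allocator (R : realType) (eps : R) (M : nat)
    (A : rstrategy R) : Prop :=
  (forall s w, admissible eps M s -> is_allocation M s (rs_run A w s)) /\
  (forall s x, admissible eps M s -> live s x ->
     measurable_fun [set: rs_space A] (fun w => rs_run A w s x)).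

(* The update sequence is fixed before the randomness is drawn. *)
Definition expected_overhead_le (R : realType) (eps : R) (M : nat)
    (A : rstrategy R) (b : R) : Prop :=
  forall s i, admissible eps M s -> (i < size s)%N ->
    ('E_(rs_prob A)[fun w => overhead R (rs_run A w) s i] <= b%:E)%E.

(* Main.v *)
Require Import Defs.
From mathcomp Require Import all_boot all_order all_algebra.
From mathcomp Require Import all_classical all_reals all_analysis.
From mathcomp Require Import measurable_realfun zify ring lra.

Import Order.TTheory GRing.Theory Num.Theory.

(**
Fill a memory of M slots, up to one free slot, with N = Theta(log(1/eps))
objects whose sizes are within a factor 2 of each other and whose subset sums
are pairwise at distance at least 2. The position of an object then determines
the set of objects to its left. Now delete two objects i and j and insert one
object of size mu(i) + mu(j): every object that lay between i and j must move,
since its old set of predecessors contains exactly one of i and j. Among any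
three objects one lies between the other two, so a pair (i, j) chosen uniformly
at random, independently of the allocator, has (N - 2)/3 objects between it on
average. All sizes being comparable, one of the three last updates has expected
overhead Omega(N).
*)

Local Open Scope nat_scope.

(** * Object sizes with well-separated subset sums *)

Lemma sum_pow2_lt n (P : pred nat) : \sum_(i < n | P i) 2 ^ i < 2 ^ n.
Proof.
elim: n => [|n IH]; first by rewrite big_ord0.
rewrite big_mkcond big_ord_recr /= -big_mkcond /= expnS.
by case: (P n); rewrite /= mul2n -addnn ?addn0 ?ltn_add2r// (leq_trans IH)// leq_addr.
Qed.

(** Uniqueness of binary digits: parity determines digit 0, and halving the rest passes to the
    shifted predicates. *)
Lemma sum_pow2_inj n (P Q : pred nat) :
  \sum_(i < n | P i) 2 ^ i = \sum_(i < n | Q i) 2 ^ i ->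
  forall i, i < n -> P i = Q i.
Proof.
have split0 m (T : pred nat) : \sum_(i < m.+1 | T i) 2 ^ i =
    T 0 + 2 * \sum_(i < m | T i.+1) 2 ^ i.
  rewrite big_mkcond big_ord_recl big_distrr /= [in RHS]big_mkcond.
  congr (_ + _).
  by apply: eq_bigr => i _; rewrite /bump add1n expnS.
elim: n P Q => [|n IH] P Q //; rewrite !split0 => eqPQ.
have P0 : P 0 = Q 0.
  move: eqPQ; move: (\sum_(i < n | P i.+1) _) (\sum_(i < n | Q i.+1) _) => a b.
  by case: (P 0); case: (Q 0) => //=; lia.
move: eqPQ; rewrite P0 => eqPQ [|i] //; rewrite ltnS.
apply: (IH (P \o succn) (Q \o succn)) => /=.
by move/addnI/eqP: eqPQ; rewrite eqn_pmul2l// => /eqP.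
Qed.

(** The term [2 ^ N] keeps all sizes within a factor 2 for [k < N], the digit [2 ^ k] tells subsets
    apart, and the outer factor 2 separates distinct sums by at least 2. *)
Definition weight (N k : nat) : nat := 2 * (2 ^ N + 2 ^ k).

Lemma weight_ge N k : 2 ^ N.+1 <= weight N k.
Proof. by rewrite /weight expnS; lia. Qed.

Lemma weight_gt0 N k : 0 < weight N k.
Proof. by apply: leq_trans (weight_ge N k); rewrite expn_gt0. Qed.

Lemma weight_le N k : k < N -> weight N k <= 2 * 2 ^ N.+1.
Proof.
move=> kN; have : 2 ^ k <= 2 ^ N by rewrite leq_exp2l// ltnW.
by rewrite /weight expnS; lia.
Qed.

(* The weights are even, so subset sums that differ by at most 1 are equal. *)
Lemma weight_sum_inj N (P Q : pred nat) :
  \sum_(i < N | P i) weight N i <= (\sum_(i < N | Q i) weight N i).+1 ->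
  \sum_(i < N | Q i) weight N i <= (\sum_(i < N | P i) weight N i).+1 ->
  forall i, i < N -> P i = Q i.
Proof.
have sumE (T : pred nat) : \sum_(i < N | T i) weight N i =
    2 * (#|[pred i : 'I_N | T i]| * 2 ^ N + \sum_(i < N | T i) 2 ^ i).
  by rewrite -big_distrr /= big_split /= sum_nat_const.
rewrite !sumE => le1 le2; apply: sum_pow2_inj.
(* Reduction modulo [2 ^ N] discards the number of summands and leaves only the binary digits. *)
have /(congr1 (modn^~ (2 ^ N))) : #|[pred i : 'I_N | P i]| * 2 ^ N +
  \sum_(i < N | P i) 2 ^ i = #|[pred i : 'I_N | Q i]| * 2 ^ N +
  \sum_(i < N | Q i) 2 ^ i by lia.
by rewrite !modnMDl !modn_small ?sum_pow2_lt.
Qed.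

(** The left side is the number of slots used later. That it is only exponential in [N] is what
    allows [N] to be logarithmic in the inverse of [eps]. *)
Lemma sum_weight_lt N : 0 < N -> (\sum_(i < N) weight N i).+1 <= 16 ^ N.
Proof.
move=> N0; rewrite -big_distrr big_split /= sum_nat_const card_ord.
have := sum_pow2_lt N predT; have := ltn_expl N (isT : 1 < 2).
have -> : 16 ^ N = 2 ^ N * 2 ^ N * (2 ^ N * 2 ^ N) by rewrite -!expnMn.
have : 2 <= 2 ^ N by rewrite -{1}(expn1 2) leq_exp2l.
move: (2 ^ N) (\sum_(i < N) _) => p S p2 Np Sp.
have ? : N * p + p <= p * p by nia.
by nia.
Qed.

(** * Positions in an almost full memory *)

Lemma sum_nat_indicator a b u v : a <= u -> u <= v -> v <= b ->
  \sum_(a <= k < b) (u <= k < v) = v - u.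
Proof.
move=> au uv vb; rewrite (big_cat_nat (n := v))//=; last by lia.
rewrite (big_cat_nat (n := u))//=.
rewrite big_nat big1 => [|k ?]; last by lia.
rewrite add0n [X in _ + X]big_nat [X in _ + X]big1 => [|k ?]; last by lia.
rewrite addn0 (eq_big_nat _ _ (F2 := fun=> 1)) => [|k ?]; last by lia.
by rewrite sum_nat_const_nat muln1.
Qed.

(** Double counting: each point of [[a, b)] lies in at most one interval. *)
Lemma sum_disjoint_intervals (I : finType) (P : pred I) (start len : I -> nat)
    (a b : nat) :
  (forall i, P i -> a <= start i /\ start i + len i <= b) ->
  (forall i j k, P i -> P j -> start i <= k < start i + len i ->
     start j <= k < start j + len j -> i = j) ->
  \sum_(i | P i) len i <= b - a.
Proof.
move=> bnd disj; have -> : \sum_(i | P i) len i =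
    \sum_(i | P i) \sum_(a <= k < b) (start i <= k < start i + len i).
  by apply: eq_bigr => i /bnd[? ?]; rewrite sum_nat_indicator//; lia.
rewrite exchange_big/= -[leqRHS]muln1 -sum_nat_const_nat leq_sum// => k _.
rewrite -big_mkcondr/= sum1_card; apply/card_le1_eqP => i j.
by rewrite /in_mem/= => /andP[Pi ki] /andP[Pj kj]; exact: disj Pj Pi kj ki.
Qed.

Lemma allocation_disjoint M s phi x y k : is_allocation M s phi ->
  live s x -> live s y -> phi x <= k < phi x + osize s x ->
  phi y <= k < phi y + osize s y -> x = y.
Proof.
move=> [_ disj] lx ly kx ky; apply/eqP/negPn/negP => /eqP xy.
have : (slots s phi x `&` slots s phi y)%classic k by split.
by rewrite disj.
Qed.

Definition before_sum (s : seq update) (phi : nat -> nat) (p : nat) : nat :=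
  \sum_(x < size s | live s x && (phi x < p)) osize s x.

(** The objects starting before [y] also end by [phi y]: one reaching further would cover slot
    [phi y], which [y] occupies because its size is positive. *)
Lemma before_sum_le M s phi y : is_allocation M s phi -> live s y ->
  0 < osize s y -> before_sum s phi (phi y) <= phi y.
Proof.
move=> al ly y0; rewrite /before_sum -[leqRHS]subn0.
apply: (@sum_disjoint_intervals 'I_(size s) _ (fun x => phi x)) => [x /andP[lx xy]|x z k /andP[lx _] /andP[lz _]].
- split=> //; rewrite leqNgt; apply/negP => yx.
  suff xE : val x = y by move: xy; rewrite xE ltnn.
  apply: (allocation_disjoint _ _ _ _ _ (phi y) al lx ly).
    by rewrite (ltnW xy).
  by rewrite leqnn -[ltnLHS]addn0 ltn_add2l.
- by move=> kx kz; apply: val_inj; exact: (allocation_disjoint _ _ _ _ _ k al).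
Qed.

(** The remaining objects, [y] included, are packed into [[phi y, M)]. Together with
    [before_sum_le], this fixes [phi y] up to the amount of free space. *)
Lemma before_sum_ge M s phi y : is_allocation M s phi -> live s y ->
  phi y + total_size s <= M + before_sum s phi (phi y).
Proof.
move=> al ly; rewrite /total_size (bigID (fun x : 'I_ _ => phi x < phi y))/=.
rewrite -/(before_sum s phi (phi y)).
set t := (X in _ + (_ + X) <= _).
have : t <= M - phi y.
  apply: (@sum_disjoint_intervals 'I_(size s) _ (fun x => phi x)) => [x /andP[lx]|x z k /andP[lx _] /andP[lz _]].
  - by rewrite -leqNgt => ?; split=> //; case: al => /(_ _ lx)[].
  - by move=> kx kz; apply: val_inj; exact: (allocation_disjoint _ _ _ _ _ k al).
have [/(_ _ ly)[yM _] _] := al; lia.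
Qed.

(** * The update sequences and their live objects *)

Definition initial (N : nat) : seq update :=
  mkseq (fun k => Insert (weight N k)) N.

(** The merged object is named [N.+2], the position of its insertion; names [N] and [N.+1] belong to
    the deletions and denote no object. *)
Definition merging (N i j : nat) : seq update :=
  initial N ++ [:: Delete i; Delete j; Insert (weight N i + weight N j)].

Lemma size_merging N i j : size (merging N i j) = N.+3.
Proof. by rewrite size_cat size_mkseq addn3. Qed.

Lemma upd_at_initial_cat N l k : k < N ->
  upd_at (initial N ++ l) k = Insert (weight N k).
Proof. by move=> kN; rewrite /upd_at nth_cat size_mkseq kN nth_mkseq. Qed.

Lemma osize_initial_cat N l k : k < N -> osize (initial N ++ l) k = weight N k.
Proof. by move=> kN; rewrite /osize upd_at_initial_cat. Qed.

Lemma upd_at_cat_initial N l k : upd_at (initial N ++ l) (N + k) = upd_at l k.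
Proof. by rewrite /upd_at nth_cat size_mkseq ltnNge leq_addr addKn. Qed.

Lemma osize_cat_initial N l k : osize (initial N ++ l) (N + k) = osize l k.
Proof. by rewrite /osize upd_at_cat_initial. Qed.

Lemma has_deletes_initial N k : has (deletes k) (initial N) = false.
Proof. by apply/negbTE; rewrite has_map -all_predC; apply/allP. Qed.

Lemma live_initial_cat N l k : k < N ->
  live (initial N ++ l) k = ~~ has (deletes k) l.
Proof.
move=> kN; rewrite /live upd_at_initial_cat// size_cat size_mkseq has_cat.
by rewrite (leq_trans kN (leq_addr _ _)) has_deletes_initial.
Qed.

Lemma live_cat_initial N l k : live (initial N ++ l) (N + k) =
  [&& k < size l, inserts (upd_at l k) & ~~ has (deletes (N + k)) l].
Proof.
rewrite /live upd_at_cat_initial size_cat size_mkseq ltn_add2l has_cat.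
by rewrite has_deletes_initial.
Qed.

Lemma take_merging N i j t : take (N + t) (merging N i j) =
  initial N ++ take t [:: Delete i; Delete j; Insert (weight N i + weight N j)].
Proof. by rewrite take_cat size_mkseq ltnNge leq_addr/= addKn. Qed.

Lemma total_size_initial N : total_size (initial N) = \sum_(k < N) weight N k.
Proof.
rewrite /total_size size_mkseq; apply: eq_big => [k|k _].
  by rewrite -[initial N]cats0 live_initial_cat.
by rewrite -[initial N]cats0 osize_initial_cat.
Qed.

Lemma before_sum_initial N phi p :
  before_sum (initial N) phi p = \sum_(k < N | phi k < p) weight N k.
Proof.
rewrite /before_sum size_mkseq; apply: eq_big => [k|k _].
  by rewrite -[initial N]cats0 live_initial_cat.
by rewrite -[initial N]cats0 osize_initial_cat.
Qed.

(** The merged object is split back into [i] and [j], both inheriting its status under [P]. Sums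
    before and after the merge thus become subset sums of the same weights, ready for
    [weight_sum_inj]. *)
Lemma sum_merging N i j (P : pred nat) : i < N -> j < N -> i != j ->
  \sum_(k < size (merging N i j) | live (merging N i j) k && P k)
    osize (merging N i j) k =
  \sum_(k < N | if (val k == i) || (val k == j) then P N.+2 else P k)
    weight N k.
Proof.
move=> iN jN ij; rewrite size_merging big_mkcond !big_ord_recr /=.
have -> : live (merging N i j) N = false.
  by rewrite -[X in live _ X]addn0 live_cat_initial.
have -> : live (merging N i j) N.+1 = false.
  by rewrite -[X in live _ X]addn1 live_cat_initial.
have -> : live (merging N i j) N.+2 = true.
  by rewrite -[X in live _ X]addn2 live_cat_initial/=; lia.
have -> : osize (merging N i j) N.+2 = weight N i + weight N j.
  by rewrite -[X in osize _ X]addn2 osize_cat_initial.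
rewrite /= !addn0 (bigID (fun k : 'I_N => (val k == i) || (val k == j)))/=.
rewrite [RHS](bigID (fun k : 'I_N => (val k == i) || (val k == j)))/=.
rewrite big1 => [|k kij]; last first.
  by rewrite live_initial_cat//= !orbF negb_or; case/orP: kij => ->; rewrite ?andbF.
rewrite add0n addnC; congr (_ + _); last first.
  rewrite -big_mkcondr/=; apply: eq_big => [k|k _]; last by rewrite osize_initial_cat.
  rewrite live_initial_cat//= !orbF.
  by case: (_ || _); rewrite ?andbF ?andbT.
rewrite (eq_bigl (fun k : 'I_N => ((val k == i) || (val k == j)) && P N.+2)); last first.
  by move=> k; case: (_ || _); rewrite ?andbF ?andbT.
case: (P N.+2); last by rewrite big_pred0// => k; rewrite andbF.
rewrite (bigD1 (Ordinal iN))/=; last by rewrite eqxx.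
rewrite (bigD1 (Ordinal jN))/=; last by rewrite eqxx orbT eq_sym.
rewrite big_pred0 ?addn0// => k.
by rewrite -!val_eqE/=; case: (_ == i); case: (_ == j).
Qed.

Lemma total_size_merging N i j : i < N -> j < N -> i != j ->
  total_size (merging N i j) = \sum_(k < N) weight N k.
Proof.
move=> iN jN ij; have := sum_merging N i j predT iN jN ij.
rewrite /total_size; under eq_bigl do rewrite andbT; move=> ->.
by apply: eq_bigl => k; case: ifP.
Qed.

(** * Objects forced to move by a merge *)

Definition between (phi : nat -> nat) (i j y : nat) : bool :=
  (phi i < phi y < phi j) || (phi j < phi y < phi i).

(* Up to the single free slot, the position of [y] is the total size of the
   objects preceding it, and this total determines which objects those are.
   If [y] does not move, both or neither of [i] and [j] must precede it, since
   they end up in one object. *)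
Lemma between_moves N i j y phi phi' : i < N -> j < N -> i != j ->
  y < N -> y != i -> y != j ->
  is_allocation (\sum_(k < N) weight N k).+1 (initial N) phi ->
  is_allocation (\sum_(k < N) weight N k).+1 (merging N i j) phi' ->
  between phi i j y -> phi y != phi' y.
Proof.
move=> iN jN ij yN yi yj al al'.
apply: contraL => /eqP yE.
have ly : live (initial N) y by rewrite -[initial N]cats0 live_initial_cat.
have y0 : 0 < osize (initial N) y.
  by rewrite -[initial N]cats0 osize_initial_cat// weight_gt0.
have ly' : live (merging N i j) y.
  by rewrite live_initial_cat//= (negbTE yi) (negbTE yj).
have y0' : 0 < osize (merging N i j) y by rewrite osize_initial_cat// weight_gt0.
have := before_sum_le _ _ _ _ al ly y0; have := before_sum_ge _ _ _ _ al ly.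
have := before_sum_le _ _ _ _ al' ly' y0'.
have := before_sum_ge _ _ _ _ al' ly'.
rewrite total_size_initial total_size_merging// before_sum_initial.
rewrite /before_sum (sum_merging N i j (fun k => phi' k < phi' y))// -yE.
have cancel p S b : p + S <= S.+1 + b -> p <= b.+1 by lia.
move=> /cancel h1 h2 /cancel h3 h4.
have PQ := weight_sum_inj N (fun k => phi k < phi y)
  (fun k => if (k == i) || (k == j) then phi' N.+2 < phi y else phi' k < phi y).
have {}PQ := PQ (leq_trans h4 h1) (leq_trans h2 h3).
have : (phi i < phi y) = (phi j < phi y) by rewrite !PQ// !eqxx orbT.
by rewrite /between; lia.
Qed.

Lemma allocation_inj M N phi i j : is_allocation M (initial N) phi ->
  i < N -> j < N -> phi i = phi j -> i = j.
Proof.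
move=> al iN jN pij; have slot k : k < N -> live (initial N) k /\
    phi k <= phi k < phi k + osize (initial N) k.
  move=> kN; rewrite -[initial N]cats0 live_initial_cat// osize_initial_cat//.
  by rewrite leqnn -[X in X < _]addn0 ltn_add2l weight_gt0.
have [li si] := slot i iN; have [lj sj] := slot j jN.
by apply: (allocation_disjoint _ _ _ _ _ (phi i) al li lj si); rewrite pij.
Qed.

(** * Counting the objects between a pair *)

Lemma sum_rot (I : finType) (H : I -> I -> I -> nat) :
  \sum_i \sum_j \sum_y H i j y = \sum_i \sum_j \sum_y H y i j.
Proof.
rewrite [RHS](eq_bigr (fun i => \sum_y \sum_j H y i j)) => [|i _].
  by rewrite [RHS]exchange_big.
by rewrite exchange_big.
Qed.

Lemma sum_distinct_triples N :
  \sum_(i < N) \sum_(j < N) \sum_(y < N) [&& i != j, y != i & y != j] =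
  N * N.-1 * N.-2.
Proof.
transitivity (\sum_(i < N) \sum_(j < N | j != i) N.-2); last first.
  under eq_bigr => i _ do rewrite sum_nat_const cardC1 card_ord.
  by rewrite sum_nat_const card_ord mulnA.
apply: eq_bigr => i _; rewrite [RHS]big_mkcond; apply: eq_bigr => j _.
rewrite eq_sym; case: eqVneq => [//|/= ji]; first by rewrite big1.
rewrite -(big_mkcond (fun y : 'I_N => (y != i) && (y != j)) (fun=> 1)).
have : \sum_(y < N) 1 = N by rewrite sum_nat_const card_ord muln1.
by rewrite (bigD1 i)//= (bigD1 j)//= => /(congr1 (fun n => n.-2)).
Qed.

(** The sum is written three times, with the role of the middle object played by each index in turn.
    For a triple of distinct indices the positions are distinct, so one of the three terms is 1. *)
Lemma sum_between N phi : {in gtn N &, injective phi} ->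
  N * N.-1 * N.-2 <= 3 * \sum_(i < N) \sum_(j < N) \sum_(y < N)
    [&& i != j, y != i, y != j & between phi i j y].
Proof.
move=> inj; set S := \sum_(i < N) _.
pose F (i j y : 'I_N) : nat := [&& i != j, y != i, y != j & between phi i j y].
have S1 : S = \sum_i \sum_j \sum_y F y i j by rewrite -sum_rot.
have S2 : S = \sum_i \sum_j \sum_y F j y i.
  by rewrite S1 (sum_rot _ (fun i j y => F y i j)).
have -> : 3 * S = S + S + S by rewrite !mulSn mul0n addn0 addnA.
rewrite {2}S1 {2}S2 /S -sum_distinct_triples -!big_split /= leq_sum// => i _.
rewrite -!big_split /= leq_sum// => j _; rewrite -!big_split /= leq_sum// => y _.
rewrite /F /between; case: (eqVneq i j) => //= ij; case: (eqVneq y i) => //= yi.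
case: (eqVneq y j) => //= yj.
have neq (a b : 'I_N) : a != b -> phi a != phi b.
  by apply: contra => /eqP /inj ab; apply/eqP/val_inj/ab; rewrite inE ltn_ord.
have := neq _ _ ij; have := neq _ _ yi; have := neq _ _ yj.
case: (ltngtP (phi i) (phi j)); case: (ltngtP (phi y) (phi i));
  case: (ltngtP (phi y) (phi j)) => //; lia.
Qed.

Local Open Scope ring_scope.

(** * Admissibility of the update sequences *)

Lemma admissible_take (R : realType) (eps : R) M s i :
  admissible eps M s -> admissible eps M (take i s).
Proof.
move=> [val load]; split=> k; rewrite size_take_min => ki.
- have [ki1 ks] : (k < i)%N /\ (k < size s)%N by lia.
  by rewrite /upd_at nth_take// take_takel ?(ltnW ki1)//; exact: val.
- by rewrite take_takel; [apply: load|]; lia.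
Qed.

Lemma valid_merging N i j : (i < N)%N -> (j < N)%N -> i != j ->
  valid_updates (merging N i j).
Proof.
move=> iN jN ij k; rewrite size_merging => kN.
have [{}kN|Nk] := ltnP k N; first by rewrite upd_at_initial_cat// weight_gt0.
rewrite -(subnKC Nk) upd_at_cat_initial take_merging.
have : (k - N < 3)%N by lia.
case: (k - N)%N => [|[|[|//]]] _ /=.
- by rewrite live_initial_cat.
- by rewrite live_initial_cat//= orbF eq_sym.
- by rewrite addn_gt0 weight_gt0.
Qed.

Lemma total_size_take_merging N i j k : (i < N)%N -> (j < N)%N -> i != j ->
  (total_size (take k (merging N i j)) <= \sum_(x < N) weight N x)%N.
Proof.
move=> iN jN ij; have [kN|Nk] := ltnP k N.+3; last first.
  by rewrite take_oversize ?size_merging// total_size_merging.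
(* The deletions at positions [N] and [N.+1] have [osize] 0, so every proper prefix is bounded by
   the initial total. *)
have sumN2 : (\sum_(x < N.+2) osize (merging N i j) x = \sum_(x < N) weight N x)%N.
  rewrite !big_ord_recr/= -[X in (_ + osize _ X)%N]addn1.
  rewrite -[X in (_ + osize _ X + _)%N]addn0 !osize_cat_initial /= !addn0.
  by apply: eq_bigr => x _; rewrite osize_initial_cat.
rewrite -sumN2 /total_size size_take_min size_merging.
have -> : minn k N.+3 = k by lia.
rewrite -(subnKC (ltnSE kN)) big_split_ord/=.
apply: leq_trans (leq_addr _ _); rewrite big_mkcond leq_sum// => x _ /=.
by case: ifP => // _; rewrite /osize /upd_at nth_take.
Qed.

Lemma admissible_merging (R : realType) (eps : R) N i j :
  (i < N)%N -> (j < N)%N -> i != j ->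
  eps * (\sum_(k < N) weight N k).+1%:R <= 1 ->
  admissible eps (\sum_(k < N) weight N k).+1 (merging N i j).
Proof.
move=> iN jN ij epsS; split=> [|k _]; first exact: valid_merging.
apply: (@le_trans _ _ (\sum_(k < N) weight N k)%N%:R).
  by rewrite ler_nat total_size_take_merging.
(* With [M] one more than the total weight, the load bound is exactly [eps * M <= 1]. *)
by rewrite mulrBl mul1r lerBrDr -[leRHS]natr1 lerD2l.
Qed.

(** The largest update inserts two weights at once, each at most [2 * 2 ^ N.+1]. *)
Lemma upd_size_merging N i j t : (i < N)%N -> (j < N)%N -> (t < 3)%N ->
  (0 < upd_size (merging N i j) (N + t) <= 4 * 2 ^ N.+1)%N.
Proof.
move=> iN jN; rewrite /upd_size upd_at_cat_initial.
have := weight_le _ _ iN; have := weight_le _ _ jN.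
have := weight_gt0 N i; have := weight_gt0 N j.
by case: t => [|[|[|//]]] /=; rewrite ?osize_initial_cat//; lia.
Qed.

Lemma live_take_merging N i j t y : (y < N)%N -> y != i -> y != j ->
  live (take (N + t) (merging N i j)) y.
Proof.
move=> yN yi yj; rewrite take_merging live_initial_cat//.
by case: t => [|[|[|t]]] //=; rewrite (negbTE yi) ?(negbTE yj) //=; case: t.
Qed.

(** * Lower bounds on the overhead of a deterministic strategy *)

Lemma overhead_ge0 (R : realType) (a : strategy) s i : 0 <= overhead R a s i.
Proof. by rewrite /overhead addr_ge0// mulr_ge0// invr_ge0. Qed.

(** Each moved object counted has size at least [2 ^ N.+1] and the update has size at most four
    times that, so it contributes at least 1/4. The objects [i] and [j] are left out because they
    may no longer be live. *)
Lemma overhead_merging_ge (R : realType) (a : strategy) N i j t :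
  (i < N)%N -> (j < N)%N -> (t < 3)%N ->
  (\sum_(y < N) [&& val y != i, val y != j &
     a (take (N + t) (merging N i j)) y !=
     a (take (N + t.+1) (merging N i j)) y])%N%:R <=
  4 * overhead R a (merging N i j) (N + t).
Proof.
move=> iN jN t3; rewrite /overhead -addnS.
set cnt := (\sum_(y < N) _)%N; set moved := (\sum_(x < N + t | _) _)%N.
have le_moved : (2 ^ N.+1 * cnt <= moved)%N.
  rewrite /moved /cnt big_split_ord/=; apply: leq_trans (leq_addr _ _).
  rewrite big_distrr [leqRHS]big_mkcond /= leq_sum// => y _.
  case: ifP => [_|]; rewrite ?osize_initial_cat//.
    by rewrite (leq_trans _ (weight_ge N y))// -[leqRHS]muln1 leq_mul// leq_b1.
  case: (eqVneq (val y) i) => [_|yi]; first by rewrite muln0.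
  case: (eqVneq (val y) j) => [_|yj]; first by rewrite muln0.
  by rewrite !live_take_merging//= => ->; rewrite muln0.
have /andP[u0 u4] := upd_size_merging N i j t iN jN t3.
have u0R : 0 < (upd_size (merging N i j) (N + t))%:R :> R by rewrite ltr0n.
rewrite mulrDr mulr1; apply: ler_wpDl => //.
rewrite mulrCA ler_pdivlMl// -!natrM ler_nat.
apply: leq_trans (leq_mul u4 (leqnn cnt)) _.
by rewrite -mulnA leq_mul2l.
Qed.

(** A position that differs between the first and last allocation has changed in at least one of the
    three updates. *)
Lemma overhead_merging_sum_ge (R : realType) (a : strategy) N i j :
  (i < N)%N -> (j < N)%N ->
  (\sum_(y < N) [&& val y != i, val y != j &
     a (initial N) y != a (merging N i j) y])%N%:R <=
  4 * \sum_(t < 3) overhead R a (merging N i j) (N + t).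
Proof.
move=> iN jN; rewrite mulr_sumr.
apply: (@le_trans _ _ (\sum_(t < 3) (\sum_(y < N) [&& val y != i, val y != j &
    a (take (N + t) (merging N i j)) y !=
    a (take (N + t.+1) (merging N i j)) y])%N%:R)); last first.
  by apply: ler_sum => t _; exact: overhead_merging_ge.
rewrite -natr_sum ler_nat exchange_big leq_sum// => y _.
rewrite !big_ord_recl big_ord0 /= !addn0 /bump /= !add1n.
have -> : take N (merging N i j) = initial N.
  by rewrite -[X in take X]addn0 take_merging take0 cats0.
have -> : take (N + 3) (merging N i j) = merging N i j.
  by rewrite take_oversize// size_merging addn3.
case: (_ != i) => //=; case: (_ != j) => //=.
case: (eqVneq (a (initial N) y) (a (take (N + 1) _) y)) => [->|] //=.
case: (eqVneq (a (take (N + 1) _) y) (a (take (N + 2) _) y)) => [->|] //=.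
all: by move=> _; rewrite ?add0n (leq_trans (leq_b1 _))// leq_addr.
Qed.

(** The allocation of [initial N] is the same for all pairs, so [sum_between] applies to it. The
    constant 12 is its factor 3 times the 4 of [overhead_merging_sum_ge]. *)
Lemma pair_overhead_sum_ge (R : realType) (a : strategy) N
    (M := (\sum_(k < N) weight N k).+1) : (1 < N)%N ->
  is_allocation M (initial N) (a (initial N)) ->
  (forall i j, (i < N)%N -> (j < N)%N -> i != j ->
     is_allocation M (merging N i j) (a (merging N i j))) ->
  (N * N.-1 * N.-2)%N%:R <= 12 * \sum_(i < N) \sum_(j < N)
    (i != j)%:R * \sum_(t < 3) overhead R a (merging N i j) (N + t).
Proof.
move=> N1 al0 al.
have inj : {in gtn N &, injective (a (initial N))}.
  move=> i j; rewrite !inE => iN jN; exact: (allocation_inj _ _ _ _ _ al0).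
apply: (@le_trans _ _ (3 * \sum_(i < N) \sum_(j < N) \sum_(y < N)
    [&& i != j, y != i, y != j & between (a (initial N)) i j y])%N%:R).
  by rewrite ler_nat sum_between.
rewrite natrM (_ : 12 = 3%:R * 4 :> R); last by ring.
rewrite -mulrA ler_pM2l// natr_sum mulr_sumr ler_sum// => i _.
rewrite natr_sum mulr_sumr ler_sum// => j _.
have [_|ij] /= := eqVneq i j; first by rewrite big1// mul0r mulr0.
rewrite mul1r; apply: (le_trans _ (overhead_merging_sum_ge R a N i j _ _)) => //.
rewrite ler_nat leq_sum// => y _; rewrite !val_eqE.
have [//|yi] /= := eqVneq y i; have [//|yj] /= := eqVneq y j.
have := between_moves N i j y (a (initial N)) (a (merging N i j))
  (ltn_ord i) (ltn_ord j) ij (ltn_ord y) yi yj al0.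
by case: between => // /(_ (al _ _ (ltn_ord i) (ltn_ord j) ij) isT) ->.
Qed.

(** * Averaging over pairs and over the randomness *)

Lemma measurable_overhead (R : realType) (eps : R) M (A : rstrategy R) s i :
  is_allocator eps M A -> admissible eps M s ->
  measurable_fun [set: rs_space A] (fun w => overhead R (rs_run A w) s i).
Proof.
move=> [_ mA] adm; rewrite /overhead.
apply: measurable_funD => //; apply: measurable_funM => //.
under eq_fun => w do rewrite big_mkcond natr_sum.
apply: measurable_sum => x; case lx : (live (take i s) x) => //=.
case lx' : (live (take i.+1 s) x) => //=.
under eq_fun do rewrite (fun_if (fun n : nat => n%:R)).
apply: measurable_fun_ifT => //; apply: measurable_neg.
by apply: measurable_fun_eqn; apply: mA => //; exact: admissible_take.
Qed.

(** The pointwise bound of [pair_overhead_sum_ge] is integrated. There are [N * N.-1] ordered pairs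
    with three updates each, all of expected overhead at most [b]; dividing by [N * N.-1] leaves the
    constant 12 * 3 = 36. *)
Lemma expected_overhead_ge (R : realType) (eps b : R) (A : rstrategy R) N
    (M := (\sum_(k < N) weight N k).+1) :
  (2 < N)%N -> eps * M%:R <= 1 -> is_allocator eps M A ->
  expected_overhead_le eps M A b -> (N - 2)%:R <= 36 * b.
Proof.
move=> N2 epsM isA Ab; set P := rs_prob A.
(* Diagonal pairs, for which [merging] is not a valid sequence, get the value 0. *)
pose X (q : 'I_N * 'I_N * 'I_3) w : R :=
  if q.1.1 != q.1.2
  then overhead R (rs_run A w) (merging N q.1.1 q.1.2) (N + q.2) else 0.
have adm i j : (i < N)%N -> (j < N)%N -> i != j ->
  admissible eps M (merging N i j) by move=> *; exact: admissible_merging.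
have X0 q w : 0 <= X q w by rewrite /X; case: ifP => // _; exact: overhead_ge0.
have mX q : measurable_fun [set: rs_space A] (X q).
  rewrite /X; case: (boolP (q.1.1 != q.1.2)) => [ij|//].
  by apply: (measurable_overhead R eps M A _ _ isA); exact: adm.
have XP q : (\int[P]_w (X q w)%:E <= ((q.1.1 != q.1.2)%:R * b)%:E)%E.
  rewrite /X; case: (boolP (q.1.1 != q.1.2)) => [ij|_]; last by rewrite mul0r integral0.
  rewrite mul1r; have := Ab _ (N + q.2)%N (adm _ _ (ltn_ord _) (ltn_ord _) ij).
  by rewrite unlock; apply; rewrite size_merging -(addn3 N) ltn_add2l.
have sum_le : (\int[P]_w (\sum_q X q w)%:E <=
    (\sum_(q : 'I_N * 'I_N * 'I_3) (q.1.1 != q.1.2)%:R * b)%:E)%E.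
  under eq_integral do rewrite -sumEFin.
  rewrite ge0_integral_sum//.
  - by rewrite -sumEFin lee_sum.
  - by move=> q; apply/measurable_EFinP.
  - by move=> q w _; rewrite lee_fin.
have le_sum w : (N * N.-1 * N.-2)%N%:R <= 12 * \sum_q X q w.
  apply: (le_trans (pair_overhead_sum_ge R (rs_run A w) N _ _ _)).
  - by lia.
  (* Validity of the initial allocation comes from viewing [initial N] as a prefix of an admissible
     sequence. *)
  - have -> : initial N = take (N + 0) (merging N 0 1).
      by rewrite take_merging take0 cats0.
    by apply: isA.1; apply: admissible_take; apply: adm => //; lia.
  - by move=> i j iN jN ij; apply: isA.1; exact: adm.
  rewrite ler_pM2l// -(pair_bigA _ (fun p t => X (p, t) w))/=.
  rewrite -(pair_bigA _ (fun i j => \sum_(t < 3) X (i, j, t) w))/=.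
  rewrite ler_sum// => i _; rewrite ler_sum// => j _.
  rewrite mulr_sumr ler_sum// => t _.
  by rewrite /X/=; case: ifP; rewrite ?mul1r ?mul0r.
have : ((12^-1 * (N * N.-1 * N.-2)%N%:R)%:E <= \int[P]_w (\sum_q X q w)%:E)%E.
  rewrite -[leLHS]mule1 -(probability_setT P) -integral_cst//.
  apply: ge0_le_integral => //.
  - by move=> w _; rewrite lee_fin mulr_ge0 ?invr_ge0.
  - by apply/measurable_EFinP; exact: measurable_sum.
  - by move=> w _; rewrite lee_fin ler_pdivrMl.
move=> /le_trans /(_ sum_le); rewrite lee_fin -mulr_suml.
have -> : \sum_(q : 'I_N * 'I_N * 'I_3) (q.1.1 != q.1.2)%:R =
    3 * (N * N.-1)%:R :> R.
  rewrite -natr_sum -natrM; congr (_%:R).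
  rewrite -(pair_bigA _ (fun (p : 'I_N * 'I_N) (t : 'I_3) =>
    nat_of_bool (p.1 != p.2)))/=.
  rewrite (eq_bigr (fun p : 'I_N * 'I_N => 3 * (p.1 != p.2))%N) => [|p _]; last first.
    by rewrite sum_nat_const card_ord.
  rewrite -big_distrr/=; congr (_ * _)%N.
  rewrite -(pair_bigA _ (fun i j : 'I_N => nat_of_bool (i != j)))/=.
  rewrite (eq_bigr (fun=> N.-1)) ?sum_nat_const ?card_ord// => i _.
  rewrite -[in RHS](card_ord N) -(cardC1 i) -sum1_card [RHS]big_mkcond/=.
  by apply: eq_bigr => j _; rewrite inE eq_sym; case: eqVneq.
rewrite [in X in X -> _]natrM.
have -> : N.-2 = (N - 2)%N by lia.
have K0 : 0 < (N * N.-1)%:R :> R by rewrite ltr0n muln_gt0; lia.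
move: ((N * N.-1)%:R) ((N - 2)%:R) K0 => K n K0 h.
by rewrite -(ler_pM2l K0); lra.
Qed.

(** * Choice of [N] and of the constants *)

Theorem theorem1p3 (R : realType) :
  exists c eps0 : R,
    0 < c /\ 0 < eps0 /\
    forall eps : R, 0 < eps -> eps < eps0 ->
    forall (f : R -> R) (A : nat -> rstrategy R),
      (forall M : nat, (0 < M)%N ->
         is_allocator eps M (A M) /\
         expected_overhead_le eps M (A M) (f eps)) ->
      c * ln (eps^-1) <= f eps.
Proof.
(* The bound on [eps] forces [5 <= N], whence [N.+1 <= 2 * (N - 2)]. Then [ln (eps^-1)] is at most
   15 * 2 * 36 = 1080 times [f eps]. *)
exists 1080^-1, (16 ^+ 5)^-1.
split; first by rewrite invr_gt0 ltr0n.
split=> [|eps eps0 eps_lt f A allocA]; first by rewrite invr_gt0 exprn_gt0 ?ltr0n.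
have epsV0 : 0 < eps^-1 by rewrite invr_gt0.
have epsV : 16 ^+ 5 < eps^-1.
  by rewrite -[ltLHS]invrK ltf_pV2 ?posrE ?invr_gt0 ?exprn_gt0 ?ltr0n.
have /andP[n_le n_gt] := truncn_itv (ltW epsV0).
set n := Num.truncn eps^-1 in n_le n_gt.
have pow_le k : 16 ^+ k < eps^-1 -> (16 ^ k <= n)%N.
  by move=> kV; rewrite -ltnS -(ltr_nat R) natrX (lt_trans kV).
have /pow_le n5 := epsV.
have n0 : (0 < n)%N by apply: leq_trans n5; rewrite expn_gt0.
have /andP[Nn nN] := trunc_log_bounds (isT : (1 < 16)%N) n0.
(* The largest [N] with [16 ^ N <= n]: by [sum_weight_lt] the memory then has at most [eps^-1]
   slots, so [eps * M <= 1]. *)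
set N := trunc_log 16 n in Nn nN.
have pow_lt k : (16 ^ k <= n)%N -> (k <= N)%N.
  by move=> kn; rewrite -ltnS -(ltn_exp2l _ _ (isT : (1 < 16)%N)) (leq_ltn_trans kn).
have /pow_lt {epsV n5} N5 := n5.
have [isA Ab] := allocA (\sum_(k < N) weight N k).+1 isT.
have := expected_overhead_ge R eps (f eps) _ N _ _ isA Ab.
have -> : (2 < N)%N by lia.
move=> /(_ isT) fN; have {}fN : (N - 2)%:R <= 36 * f eps.
  apply: fN; rewrite -ler_pdivlMl// mulr1; apply: le_trans n_le.
  by rewrite ler_nat (leq_trans _ Nn)// sum_weight_lt//; lia.
have ln_le : ln (eps^-1) <= N.+1%:R * 15.
  apply: (@le_trans _ _ (ln (16 ^+ N.+1))).
    rewrite ler_ln ?posrE ?invr_gt0 ?exprn_gt0//.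
    by rewrite (le_trans (ltW n_gt))// -natrX ler_nat.
  rewrite lnXn// -[leLHS]mulr_natl ler_pM2l ?ltr0n//.
  (* The crude bound [ln (1 + x) <= x] at [x = 15] suffices for [ln 16]. *)
  rewrite (_ : 16 = 1 + 15 :> R); last by ring.
  by apply: le_ln1Dx; lra.
have : (N.+1%:R : R) <= 2 * (N - 2)%:R by rewrite -natrM ler_nat; lia.
lra.
Qed.
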